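(* Let $n\ge2$. Let $A_1=\{1\text{-}23\}$, $A_2=\{2\text{-}13,21\text{-}3\}$, $A_3=\{2\text{-}31,23\text{-}1\}$, $A_4=\{1\text{-}32,13\text{-}2\}$. For every choice of $p_i\in A_i$ ($i=1,2,3,4$), $|S_n(p_1,p_2,p_3,p_4)|=2$ and $$S_n(p_1,p_2,p_3,p_4)=\{\,n\,(n-1)\ldots 3\,2\,1,\ \ n\,(n-1)\ldots 3\,1\,2\,\}.$$
   Context: $S_n$ is the set of permutations $\pi=\pi_1\pi_2\cdots\pi_n$ of $\{1,\dots,n\}$ (written in one-line notation). For $abc$ a permutation of $123$, the generalized pattern $a\text{-}bc$ is contained in $\pi$ if there are indices $i<j$ with $j+1\le n$ such that $\pi_i\pi_j\pi_{j+1}$ is order-isomorphic to $abc$; the generalized pattern $ab\text{-}c$ is contained in $\pi$ if there are indices $i,k$ with $i+1<k\le n$ such that $\pi_i\pi_{i+1}\pi_k$ is order-isomorphic to $abc$. $\pi$ avoids a pattern if it does not contain it. $S_n(p_1,\dots,p_m)$ is the set of $\pi\in S_n$ avoiding all of $p_1,\dots,p_m$. *)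

(* Defs.v *)
From HB Require Import structures.
From mathcomp Require Import all_boot all_fingroup.

Set Implicit Arguments.
Unset Strict Implicit.
Unset Printing Implicit Defensive.

(* [pat_a_bc a b c] is the generalized pattern a-bc, in which only the letters
   matching b and c must be adjacent; [pat_ab_c a b c] is ab-c. The word abc is
   meant to be a permutation of 123. *)
Variant gpattern : Type :=
  | pat_a_bc of nat & nat & nat
  | pat_ab_c of nat & nat & nat.

Definition gpattern_encode (p : gpattern) : bool * (nat * nat * nat) :=
  match p with
  | pat_a_bc a b c => (true, (a, b, c))
  | pat_ab_c a b c => (false, (a, b, c))
  end.

Definition gpattern_decode (x : bool * (nat * nat * nat)) : gpattern :=
  let: (d, (a, b, c)) := x in
  if d then pat_a_bc a b c else pat_ab_c a b c.

Lemma gpattern_encodeK : cancel gpattern_encode gpattern_decode.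
Proof. by case. Qed.

HB.instance Definition _ := Equality.copy gpattern (can_type gpattern_encodeK).

Definition order_isomorphic (s t : seq nat) : bool :=
  (size s == size t) &&
  [forall i : 'I_(size s), forall j : 'I_(size s),
     (nth 0 s i < nth 0 s j) == (nth 0 t i < nth 0 t j)].

(* Positions and values live in 'I_n, i.e. are 0-based; this is immaterial for
   pattern containment, which only depends on their relative order. *)
Definition contains n (pi : 'S_n) (p : gpattern) : bool :=
  match p with
  | pat_a_bc a b c =>
      [exists i : 'I_n, exists j : 'I_n, exists k : 'I_n,
         [&& i < j, k == j.+1 :> nat &
             order_isomorphic [:: val (pi i); val (pi j); val (pi k)]
                              [:: a; b; c]]]
  | pat_ab_c a b c =>
      [exists i : 'I_n, exists j : 'I_n, exists k : 'I_n,
         [&& j == i.+1 :> nat, j < k &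
             order_isomorphic [:: val (pi i); val (pi j); val (pi k)]
                              [:: a; b; c]]]
  end.

Definition avoids n (pi : 'S_n) (p : gpattern) : bool := ~~ contains pi p.

Definition avoiders n (ps : seq gpattern) : {set 'S_n} :=
  [set pi : 'S_n | all (avoids pi) ps].

(* The values are shifted by one, so that words are over {1, ..., n}. *)
Definition one_line n (pi : 'S_n) : seq nat :=
  [seq (val (pi i)).+1 | i <- enum 'I_n].

Definition A1 : seq gpattern := [:: pat_a_bc 1 2 3].
Definition A2 : seq gpattern := [:: pat_a_bc 2 1 3; pat_ab_c 2 1 3].
Definition A3 : seq gpattern := [:: pat_a_bc 2 3 1; pat_ab_c 2 3 1].
Definition A4 : seq gpattern := [:: pat_a_bc 1 3 2; pat_ab_c 1 3 2].

Definition decreasing_word (n : nat) : seq nat := rev (iota 1 n).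

(* n (n-1) ... 3 1 2, for n >= 2 *)
Definition decreasing_word_12 (n : nat) : seq nat :=
  rev (iota 3 (n - 2)) ++ [:: 1; 2].

(* Main.v *)
Require Import Defs.
From mathcomp Require Import all_boot all_fingroup.

(** Both directions go through one condition: every entry except the last two
    exceeds all later entries.  If a permutation avoids the four patterns, then
    [pi_i < pi_(i+1)] with [i + 2 <= n] is impossible, because the consecutive
    entries [pi_i pi_(i+1) pi_(i+2)] would form 123, 132 or 231; avoiding 2-13 or
    21-3 then propagates [pi_i > pi_(i+1)] to all later entries.  Conversely, under
    this condition the first letter of any occurrence of a pattern is its largest
    one, whereas none of the patterns starts with 3. *)

Lemma order_isomorphic3E (x y z a b c : nat) :
  order_isomorphic [:: x; y; z] [:: a; b; c] =
  [&& (x < y) == (a < b), (y < x) == (b < a), (x < z) == (a < c),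
      (z < x) == (c < a), (y < z) == (b < c) & (z < y) == (c < b)].
Proof.
rewrite /order_isomorphic /=.
apply/forallP/and5P => [iso | [xy yx xz zx /andP[yz zy]] i].
  pose o k (lt_k3 : k < 3) := Ordinal lt_k3.
  have iso2 (i j : 'I_3) : (nth 0 [:: x; y; z] i < nth 0 [:: x; y; z] j)
                        == (nth 0 [:: a; b; c] i < nth 0 [:: a; b; c] j).
    by have /forallP := iso i; apply.
  have := (iso2 (o 0 isT) (o 1 isT), iso2 (o 1 isT) (o 0 isT), iso2 (o 0 isT) (o 2 isT),
           iso2 (o 2 isT) (o 0 isT), iso2 (o 1 isT) (o 2 isT), iso2 (o 2 isT) (o 1 isT)).
  by move=> /= -[[[[[-> ->] ->] ->] ->] ->].
apply/forallP => j.
by case: i => [[|[|[|//]]] ?]; case: j => [[|[|[|//]]] ?]; rewrite //= !ltnn.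
Qed.

(** * One-line words as rearrangements of 1, ..., n *)

Section OneLine.

Context {n : nat}.
Implicit Types pi : 'S_n.

Lemma size_one_line pi : size (one_line pi) = n.
Proof. by rewrite size_map size_enum_ord. Qed.

Lemma nth_one_line pi (i : 'I_n) : nth 0 (one_line pi) i = (pi i).+1.
Proof. by rewrite (nth_map i) ?size_enum_ord // nth_ord_enum. Qed.

Lemma one_line_inj : injective (@one_line n).
Proof.
move=> pi rho eq_w; apply/permP => i; apply: val_inj.
by have := congr1 (nth 0 ^~ i) eq_w; rewrite /= !nth_one_line => -[].
Qed.

Lemma perm_one_line pi : perm_eq (one_line pi) (iota 1 n).
Proof.
apply: uniq_perm; last move=> x; rewrite ?iota_uniq //.
  by rewrite map_inj_uniq ?enum_uniq // => i j [] /val_inj /perm_inj.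
rewrite mem_iota add1n ltnS; apply/mapP/andP => [[i _ ->] | [x_gt0 le_xn]];
  first by rewrite ltn_ord.
have lt_xn : x.-1 < n by rewrite prednK.
exists (pi^-1%g (Ordinal lt_xn)); first by rewrite mem_enum.
by rewrite permKV /= prednK.
Qed.

(** Lowering every letter by one gives an injective self-map of ['I_n], since the letters are
    distinct and lie between 1 and [n]. This is how the two target words come to be realized by
    permutations. *)
Lemma one_line_surj s : perm_eq s (iota 1 n) -> exists pi, one_line pi = s.
Proof.
move=> perm_s; have size_s : size s = n by rewrite (perm_size perm_s) size_iota.
have s_bounds (i : 'I_n) : 0 < nth 0 s i <= n.
  have : nth 0 s i \in s by rewrite mem_nth ?size_s.
  by rewrite (perm_mem perm_s) mem_iota.
have lt_f (i : 'I_n) : (nth 0 s i).-1 < n.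
  by case/andP: (s_bounds i) => gt0 le_n; rewrite prednK.
have f_inj : injective (fun i => Ordinal (lt_f i)).
  move=> i j /(congr1 val) /= eq_ij; apply: val_inj; apply/eqP.
  rewrite -(@nth_uniq _ 0 s) ?size_s ?ltn_ord ?(perm_uniq perm_s) ?iota_uniq //.
  case/andP: (s_bounds i) => i_gt0 _; case/andP: (s_bounds j) => j_gt0 _.
  by rewrite -(prednK i_gt0) -(prednK j_gt0) eq_ij.
exists (perm f_inj); apply: (@eq_from_nth _ 0) => [|k]; rewrite size_one_line //.
move=> lt_kn; rewrite (nth_one_line _ (Ordinal lt_kn)) permE /= prednK //.
by case/andP: (s_bounds (Ordinal lt_kn)).
Qed.

(** * Pattern containment read on words with natural-number positions *)

Lemma order_isomorphic_one_line pi (i j k : 'I_n) a b c :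
  order_isomorphic [:: val (pi i); val (pi j); val (pi k)] [:: a; b; c] =
  order_isomorphic [seq nth 0 (one_line pi) l | l <- [:: val i; val j; val k]]
                   [:: a; b; c].
Proof. by rewrite /= !order_isomorphic3E !nth_one_line !ltnS. Qed.

Lemma contains_a_bc pi a b c i j : i < j -> j.+1 < n ->
  order_isomorphic [seq nth 0 (one_line pi) l | l <- [:: i; j; j.+1]] [:: a; b; c] ->
  contains pi (pat_a_bc a b c).
Proof.
move=> lt_ij lt_jn iso; have lt_jn' := ltnW lt_jn.
apply/existsP; exists (Ordinal (ltn_trans lt_ij lt_jn')).
apply/existsP; exists (Ordinal lt_jn'); apply/existsP; exists (Ordinal lt_jn).
by rewrite lt_ij eqxx order_isomorphic_one_line.
Qed.

Lemma contains_ab_c pi a b c i k : i.+1 < k -> k < n ->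
  order_isomorphic [seq nth 0 (one_line pi) l | l <- [:: i; i.+1; k]] [:: a; b; c] ->
  contains pi (pat_ab_c a b c).
Proof.
move=> lt_ik lt_kn iso; have lt_in := ltn_trans lt_ik lt_kn.
apply/existsP; exists (Ordinal (ltnW lt_in)); apply/existsP; exists (Ordinal lt_in).
apply/existsP; exists (Ordinal lt_kn).
by rewrite eqxx lt_ik order_isomorphic_one_line.
Qed.

Definition letters (p : gpattern) : seq nat :=
  match p with pat_a_bc a b c | pat_ab_c a b c => [:: a; b; c] end.

(** Forgetting the adjacency requirement puts both kinds of pattern in one form, enough for showing
    avoidance. *)
Lemma contains_classical pi p : contains pi p ->
  exists i j k, [/\ i < j, j < k, k < n &
    order_isomorphic [seq nth 0 (one_line pi) l | l <- [:: i; j; k]] (letters p)].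
Proof.
case: p => a b c /existsP[i /existsP[j /existsP[k]]];
  rewrite order_isomorphic_one_line => /and3P[].
  move=> lt_ij /eqP eq_k iso; exists i, j, k.
  by split; rewrite ?ltn_ord // eq_k.
move=> /eqP eq_j lt_jk iso; exists i, j, k.
by split; rewrite ?ltn_ord // eq_j.
Qed.

(** Three consecutive positions satisfy either adjacency requirement, so the place of the dash does
    not matter there. *)
Lemma contains_consecutive pi a b c i p : i.+2 < n ->
  p \in [:: pat_a_bc a b c; pat_ab_c a b c] ->
  order_isomorphic [seq nth 0 (one_line pi) l | l <- [:: i; i.+1; i.+2]] [:: a; b; c] ->
  contains pi p.
Proof.
move=> lt_in; rewrite !inE => /orP[] /eqP-> iso.
  exact: contains_a_bc iso.
exact: contains_ab_c iso.
Qed.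

(** * Avoidance and dominance *)

Lemma nth_one_line_ltNge pi i j : i < n -> j < n -> i != j ->
  (nth 0 (one_line pi) i < nth 0 (one_line pi) j) =
  ~~ (nth 0 (one_line pi) j < nth 0 (one_line pi) i).
Proof.
move=> lt_in lt_jn ne_ij; rewrite -leqNgt ltn_neqAle nth_uniq ?size_one_line ?ne_ij //.
by rewrite (perm_uniq (perm_one_line pi)) iota_uniq.
Qed.

(** Positions are 0-based, so [i.+2 < size s] exempts exactly the last two entries from
    dominating. *)
Definition dominant (s : seq nat) : Prop :=
  forall i j, i < j -> i.+2 < size s -> j < size s -> nth 0 s j < nth 0 s i.

Lemma dominant_avoids pi p : dominant (one_line pi) ->
  ~~ (nth 0 (letters p) 1 < nth 0 (letters p) 0) ||
  ~~ (nth 0 (letters p) 2 < nth 0 (letters p) 0) -> avoids pi p.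
Proof.
rewrite /dominant size_one_line => dom not_max; apply/negP.
case/contains_classical=> i [j [k [lt_ij lt_jk lt_kn]]].
(* Two positions of the occurrence follow [i], so [i] is not one of the last two and dominance
   applies to it. *)
have lt_in : i.+2 < n by apply: leq_trans lt_kn; rewrite !ltnS (leq_trans _ lt_jk).
have lt_ji := dom i j lt_ij lt_in (ltn_trans lt_jk lt_kn).
have lt_ki := dom i k (ltn_trans lt_ij lt_jk) lt_in lt_kn.
case: p not_max => a b c /=; rewrite order_isomorphic3E lt_ji lt_ki;
  by case: (b < a); case: (c < a); rewrite //= ?andbF.
Qed.

Lemma avoids_dominant pi p1 p2 p3 p4 :
    p1 \in A1 -> p2 \in A2 -> p3 \in A3 -> p4 \in A4 ->
  all (avoids pi) [:: p1; p2; p3; p4] -> dominant (one_line pi).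
Proof.
move=> p1A p2A p3A p4A /and5P[av1 av2 av3 av4 _]; rewrite /dominant size_one_line.
set w := nth 0 (one_line pi).
have w_lt i j : i < n -> j < n -> i < j -> (w i < w j) = ~~ (w j < w i).
  by move=> lt_in lt_jn lt_ij; rewrite nth_one_line_ltNge // neq_ltn lt_ij.
have descent i : i.+2 < n -> w i.+1 < w i.
  move=> lt_i2n; have lt_i1n := ltnW lt_i2n; have lt_in := ltnW lt_i1n.
  rewrite -[w _ < _]negbK -w_lt //; apply/negP => lt01.
  have gt01 : w i.+1 < w i = false by apply/negbTE; rewrite -w_lt.
  have consec a b c p : p \in [:: pat_a_bc a b c; pat_ab_c a b c] -> avoids pi p ->
      ~~ order_isomorphic [:: w i; w i.+1; w i.+2] [:: a; b; c].
    by move=> pin; apply: contra => iso; apply: contains_consecutive pin iso.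
  have := consec 1 2 3 p1 _ av1; have := consec 2 3 1 p3 p3A av3.
  have := consec 1 3 2 p4 p4A av4; rewrite !order_isomorphic3E lt01 gt01 /=.
  rewrite (w_lt i i.+2) // (w_lt i.+1 i.+2) //.
  (* [A1] has a single element; its membership is widened to the two-element shape that [consec]
     expects. *)
  have p1A' : p1 \in [:: pat_a_bc 1 2 3; pat_ab_c 1 2 3].
    by move: p1A; rewrite !inE => ->.
  move=> + + /(_ p1A').
  (* If [w i.+2] is below [w i], it is also below [w i.+1] and the pattern is 231; otherwise
     comparing the last two entries gives 132 or 123. *)
  case: (boolP (w i.+2 < w i)) => [lt20 | _]; last by case: (w i.+2 < w i.+1).
  by rewrite (ltn_trans lt20 lt01).
move=> i j lt_ij lt_i2n lt_jn; have lt_in := ltn_trans lt_ij lt_jn.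
have desc := descent i lt_i2n.
have gtF x y (lt_xy : x < y) : (y < x) = false := leq_gtF (ltnW lt_xy).
move: p2A; rewrite !inE => /orP[] /eqP eq_p2; rewrite {}eq_p2 in av2.
  (* For 2-13, induction on [j]: if [w j < w i < w j.+1], the positions [i], [j], [j.+1] form an
     occurrence. *)
  elim: j lt_ij lt_jn => // j IHj; rewrite ltnS leq_eqVlt.
  case/predU1P=> [<- // | lt_ij] lt_j1n; have lt_jn := ltnW lt_j1n.
  have lt_ji := IHj lt_ij lt_jn; apply: contraNT av2.
  rewrite -w_lt // ?(leqW lt_ij) // => lt_ij1.
  apply: (contains_a_bc _ _ _ _ i j) => //; rewrite order_isomorphic3E -/w.
  have lt_jj1 := ltn_trans lt_ji lt_ij1.
  by rewrite lt_ji lt_ij1 lt_jj1 !(gtF _ _ lt_ji, gtF _ _ lt_ij1, gtF _ _ lt_jj1).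
move: lt_ij; rewrite leq_eqVlt => /predU1P[<- // | lt_i1j].
apply: contraNT av2; rewrite -w_lt ?(ltnW lt_i1j) // => lt_ij.
apply: (contains_ab_c _ _ _ _ i j) => //; rewrite order_isomorphic3E -/w.
have lt_i1_j := ltn_trans desc lt_ij.
by rewrite desc lt_ij lt_i1_j !(gtF _ _ desc, gtF _ _ lt_ij, gtF _ _ lt_i1_j).
Qed.

End OneLine.

(** * The dominant rearrangements of 1, ..., n *)

Lemma dominant_cat2 t a b :
  dominant (t ++ [:: a; b]) <-> pairwise gtn t && all (fun x => (a < x) && (b < x)) t.
Proof.
have sz : size (t ++ [:: a; b]) = (size t).+2 by rewrite size_cat addn2.
rewrite /dominant sz; split=> [dom | /andP[/(pairwiseP 0) dec /(all_nthP 0) top]].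
  apply/andP; split.
    apply/(pairwiseP 0) => i j; rewrite !inE => lt_it lt_jt lt_ij.
    have := dom i j lt_ij lt_it (leqW (leqW lt_jt)).
    by rewrite !nth_cat lt_it lt_jt.
  apply/(all_nthP 0) => i lt_it.
  have := dom i (size t) lt_it lt_it (leqW (leqnn _)).
  have := dom i (size t).+1 (leqW lt_it) lt_it (leqnn _).
  by rewrite !nth_cat lt_it ltnn (leq_gtF (leqnSn _)) subnn subSnn /= => -> ->.
move=> i j lt_ij lt_it lt_jt; rewrite !nth_cat.
have {}lt_it : i < size t := lt_it; rewrite lt_it.
case: (ltnP j (size t)) => [lt_j | le_tj]; first exact: dec.
have /andP[lt_a lt_b] := top i lt_it.
have : j - size t < 2 by rewrite ltn_subLR // addn2.
by case: (j - size t) => [|[|]].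
Qed.

(** Exposes the prefix shared with [decreasing_word_12], so that the two words differ only in their
    last two letters. *)
Lemma decreasing_wordE m : decreasing_word m.+2 = rev (iota 3 m) ++ [:: 2; 1].
Proof. by rewrite /decreasing_word /= !rev_cons -!cats1 -catA. Qed.

Lemma decreasing_word_12E m : decreasing_word_12 m.+2 = rev (iota 3 m) ++ [:: 1; 2].
Proof. by rewrite /decreasing_word_12 subSS subSS subn0. Qed.

Lemma perm_decreasing_word n : perm_eq (decreasing_word n) (iota 1 n).
Proof. by rewrite perm_rev. Qed.

Lemma perm_decreasing_word_12 m : perm_eq (decreasing_word_12 m.+2) (iota 1 m.+2).
Proof.
rewrite -(permPr (perm_decreasing_word _)) decreasing_wordE decreasing_word_12E.
by rewrite perm_cat2l (perm_catC [:: 1] [:: 2]).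
Qed.

Lemma gtn_trans : transitive gtn.
Proof. by move=> y x z /= lt_yx lt_zy; apply: ltn_trans lt_yx. Qed.

Lemma pairwise_gtn_rev_iota k m : pairwise gtn (rev (iota k m)).
Proof. by rewrite -(sorted_pairwise gtn_trans) rev_sorted; apply: iota_ltn_sorted. Qed.

(** Dominance leaves only the order of the last two letters free. Either the whole word decreases,
    or it does so once these two are swapped, and the decreasing rearrangement is unique. *)
Lemma dominant_wordP m s : perm_eq s (iota 1 m.+2) ->
  dominant s <-> s \in [:: decreasing_word m.+2; decreasing_word_12 m.+2].
Proof.
move=> perm_s; have size_s : size s = m.+2 by rewrite (perm_size perm_s) size_iota.
have gtn_unique u : pairwise gtn u -> perm_eq u (iota 1 m.+2) -> u = decreasing_word m.+2.
  rewrite -(permPr (perm_decreasing_word _)) => dec; apply: (sorted_eq gtn_trans).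
  - by move=> x y /= /andP[lt_yx /(ltn_trans lt_yx)]; rewrite ltnn.
  - by rewrite (sorted_pairwise gtn_trans).
  - by rewrite (sorted_pairwise gtn_trans) pairwise_gtn_rev_iota.
split; last first.
  have top : all (fun x => 2 < x) (rev (iota 3 m)).
    by apply/allP => x; rewrite mem_rev mem_iota => /andP[].
  rewrite !inE decreasing_wordE decreasing_word_12E => /orP[] /eqP->;
  apply/dominant_cat2; rewrite pairwise_gtn_rev_iota /=;
  by apply: sub_all top => x lt2x; rewrite lt2x (ltnW lt2x).
(* Two letters are peeled off the end, writing the word as [t ++ [:: a; b]]. *)
case/lastP: s size_s perm_s => // s b; rewrite size_rcons => -[].
case/lastP: s => // t a; rewrite size_rcons => -[size_t].
rewrite -!cats1 -catA cat1s => perm_s /dominant_cat2/andP[dec top].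
have ne_ab : a != b.
  have := perm_uniq perm_s; rewrite iota_uniq cat_uniq => /and3P[_ _] /=.
  by rewrite inE andbT.
rewrite !inE; have [lt_ab | le_ba] := ltnP a b.
  have perm_t : perm_eq (t ++ [:: b; a]) (iota 1 m.+2).
    by apply: perm_trans perm_s; rewrite perm_cat2l (perm_catC [:: b] [:: a]).
  have dec_t : pairwise gtn (t ++ [:: b; a]).
    rewrite pairwise_cat dec /= lt_ab !andbT allrelC /= !allrel_consl.
    by move: top; rewrite all_predI => /andP[-> ->].
  have /eqP := gtn_unique _ dec_t perm_t.
  rewrite decreasing_wordE decreasing_word_12E.
  (* Comparing the swapped word with the decreasing one gives the prefix [t] and forces [b = 2],
     [a = 1]. *)
  rewrite !eqseq_cat ?size_rev ?size_iota // => /and4P[-> /eqP-> /eqP-> _].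
  by rewrite orbT.
rewrite (gtn_unique _ _ perm_s) ?eqxx // pairwise_cat dec /= !andbT.
rewrite ltn_neqAle eq_sym ne_ab le_ba andbT allrelC !allrel_consl.
by move: top; rewrite all_predI => /andP[-> ->].
Qed.

Theorem proposition2p10 (n : nat) (hn : 2 <= n) (p1 p2 p3 p4 : gpattern)
  (hp1 : p1 \in A1) (hp2 : p2 \in A2) (hp3 : p3 \in A3) (hp4 : p4 \in A4) :
  #|avoiders n [:: p1; p2; p3; p4]| = 2 /\
  [seq one_line pi | pi in avoiders n [:: p1; p2; p3; p4]]
    =i [:: decreasing_word n; decreasing_word_12 n].
Proof.
case: n hn => [|[|m]] // _; set av := avoiders _ _.
have avE pi : pi \in av <->
    one_line pi \in [:: decreasing_word m.+2; decreasing_word_12 m.+2].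
  apply: iff_trans (dominant_wordP _ _ (perm_one_line pi)); rewrite inE; split.
    exact: avoids_dominant.
  move=> dom; apply/and5P; split=> //; apply: dominant_avoids => //.
  - by move: hp1; rewrite !inE => /eqP->.
  - by move: hp2; rewrite !inE => /orP[] /eqP->.
  - by move: hp3; rewrite !inE => /orP[] /eqP->.
  - by move: hp4; rewrite !inE => /orP[] /eqP->.
have words : [seq one_line pi | pi in av]
    =i [:: decreasing_word m.+2; decreasing_word_12 m.+2].
  move=> s; apply/imageP/idP => [[pi /avE ? ->] // | s_in].
  have [pi eq_s] : exists pi : 'S_m.+2, one_line pi = s.
    apply: one_line_surj; move: s_in; rewrite !inE => /orP[] /eqP->.
      exact: perm_decreasing_word.
    exact: perm_decreasing_word_12.
  by exists pi => //; apply/avE; rewrite eq_s.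
(* Since [one_line] is injective, the avoiders are counted by their words, and the two words have
   distinct endings. *)
split=> //; rewrite -(size_image (@one_line m.+2) av).
have uniq_av : uniq [seq one_line pi | pi in av].
  by rewrite map_inj_uniq ?enum_uniq //; apply: one_line_inj.
have uniq_words : uniq [:: decreasing_word m.+2; decreasing_word_12 m.+2].
  by rewrite /= decreasing_wordE decreasing_word_12E inE andbT eqseq_cat // eqxx.
by rewrite (perm_size (uniq_perm uniq_av uniq_words words)).
Qed.
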